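(* For every $B>0$ there exist a number of agents $n\in\mathbb{N}$ and a problem $\langle \ell,p\rangle$ with agent set $N=\{1,\dots,n\}$ such that \[ \mathbb{C}\big(\widehat\phi(\ell,p)\big) > B\cdot \mathbb{C}\big(\phi^*(\ell,p)\big), \] where $\widehat\phi(\ell,p)\in X$ and $\phi^*(\ell,p)\in X$ denote the unique Nash equilibrium profiles of the games induced, for the problem $\langle\ell,p\rangle$, by the disruptor-pays solution $\widehat\phi$ and by the solution $\phi^*$, respectively.
   Context: Agents: $N=\{1,\dots,n\}$, ordered. A problem $\langle \ell,p\rangle$ consists of losses $\ell=(\ell_1,\dots,\ell_n)\in\mathbb{R}^n_{>0}$ and technologies $p=(p_i)_{i\in N}$, where each $p_i:\mathbb{R}_{\ge 0}\to[0,1]$ is strictly increasing, strictly concave, continuous on $[0,\infty)$ and differentiable on $(0,\infty)$, with $p_i(0)=0$ and $p_i'(x_i)\to\infty$ as $x_i\to 0$. A profile is $x=(x_i)_{i\in N}\in X=\mathbb{R}^n_{\ge 0}$. A solution is a function $\phi:N\times N\to\mathbb{R}_{\ge 0}$ with $\phi(i,j)=0$ for all $j<i$ and (balance) $\sum_{j\ge i}\phi(i,j)=\sum_{j\ge i}\ell_j$ for all $i\in N$. Given $\phi$, the expected cost of agent $k$ at profile $x$ is \[ C_k(x;\phi)=\sum_{j<k}\Big(\prod_{i<j}p_i(x_i)\Big)(1-p_j(x_j))\,\phi(j,k)+\Big(\prod_{i<k}p_i(x_i)\Big)(1-p_k(x_k))\,\phi(k,k)+x_k \] (empty sums are $0$,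 empty products are $1$). The solution $\phi$ induces the simultaneous-move game in which each agent $k$ chooses $x_k\in\mathbb{R}_{\ge 0}$ to minimize $C_k(\cdot;\phi)$; each such game has a unique pure-strategy Nash equilibrium. The total cost is $\mathbb{C}(x)=\sum_{j\in N}\big(1-\prod_{i\le j}p_i(x_i)\big)\ell_j+\sum_{j\in N}x_j$. The efficient profile $x^*\in X$ is the profile with $\mathbb{C}(x^* )\le\mathbb{C}(x)$ for all $x\in X$. The disruptor-pays solution $\widehat\phi$ is given by $\widehat\phi(i,i)=\sum_{j\ge i}\ell_j$ and $\widehat\phi(i,j)=0$ for $j\neq i$. The solution $\phi^*$ is given by $\phi^*(i,i)=\ell_i+\sum_{k>i}\big(\prod_{i<j\le k}p_j(x^*_j)\big)\ell_k$, $\phi^*(i,j)=(1-p_j(x^*_j))\,\phi^*(j,j)$ for $i<j$, and $\phi^*(i,j)=0$ for $j<i$. *)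

(* Defs.v *)
From HB Require Import structures.
From mathcomp Require Import all_boot all_order all_algebra.
From mathcomp Require Import all_classical all_reals all_analysis.
Set Implicit Arguments.
Unset Strict Implicit.
Unset Printing Implicit Defensive.
Import Order.TTheory GRing.Theory Num.Theory.
Import numFieldNormedType.Exports.
Local Open Scope classical_set_scope.
Local Open Scope ring_scope.

(* Agents 1, ..., n are the ordinals 0, ..., n - 1 of 'I_n, in the same order.
   Losses and profiles are row vectors. *)

(* A technology is a total function R -> R, constrained on [0, +oo[ only; its
   values at negative arguments are junk that no definition below depends on. *)
Record technology (R : realType) (f : R -> R) : Prop := Technology {
  tech_range : forall x : R, 0 <= x -> 0 <= f x <= 1;
  tech_incr : forall x y : R, 0 <= x -> x < y -> f x < f y;
  tech_concave : forall x y t : R, 0 <= x -> 0 <= y -> x != y -> 0 < t < 1 ->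
    t * f x + (1 - t) * f y < f (t * x + (1 - t) * y);
  tech_continuous : {within `[0, +oo[, continuous f};
  tech_derivable : forall x : R, 0 < x -> derivable f x 1;
  tech_0 : f 0 = 0;
  tech_slope0 : derive1 f x @[x --> 0^'+] --> +oo%R
}.

Definition problem (R : realType) (n : nat)
    (l : 'rV[R]_n) (p : 'I_n -> R -> R) : Prop :=
  (forall i, 0 < l 0 i) /\ (forall i, technology (p i)).

Definition profile (R : realType) (n : nat) (x : 'rV[R]_n) : Prop :=
  forall i, 0 <= x 0 i.

Definition solution (R : realType) (n : nat)
    (l : 'rV[R]_n) (phi : 'I_n -> 'I_n -> R) : Prop :=
  [/\ forall i j, 0 <= phi i j,
      forall i j : 'I_n, (j < i)%N -> phi i j = 0
    & forall i : 'I_n, \sum_(j < n | (i <= j)%N) phi i j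
                = \sum_(j < n | (i <= j)%N) l 0 j].

Definition agent_cost (R : realType) (n : nat) (p : 'I_n -> R -> R)
    (phi : 'I_n -> 'I_n -> R) (x : 'rV[R]_n) (k : 'I_n) : R :=
  \sum_(j < n | (j < k)%N)
     (\prod_(i < n | (i < j)%N) p i (x 0 i)) * (1 - p j (x 0 j)) * phi j k
  + (\prod_(i < n | (i < k)%N) p i (x 0 i)) * (1 - p k (x 0 k)) * phi k k
  + x 0 k.

Definition deviate (R : realType) (n : nat)
    (x : 'rV[R]_n) (k : 'I_n) (y : R) : 'rV[R]_n :=
  \row_j (if j == k then y else x 0 j).

Definition nash (R : realType) (n : nat) (p : 'I_n -> R -> R)
    (phi : 'I_n -> 'I_n -> R) (x : 'rV[R]_n) : Prop :=
  profile x /\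
  forall (k : 'I_n) (y : R), 0 <= y ->
    agent_cost p phi x k <= agent_cost p phi (deviate x k y) k.

Definition total_cost (R : realType) (n : nat)
    (l : 'rV[R]_n) (p : 'I_n -> R -> R) (x : 'rV[R]_n) : R :=
  \sum_(j < n) (1 - \prod_(i < n | (i <= j)%N) p i (x 0 i)) * l 0 j
  + \sum_(j < n) x 0 j.

Definition efficient (R : realType) (n : nat)
    (l : 'rV[R]_n) (p : 'I_n -> R -> R) (x : 'rV[R]_n) : Prop :=
  profile x /\
  forall y : 'rV[R]_n, profile y -> total_cost l p x <= total_cost l p y.

Definition disruptor_pays (R : realType) (n : nat)
    (l : 'rV[R]_n) (i j : 'I_n) : R :=
  if j == i then \sum_(k < n | (i <= k)%N) l 0 k else 0.

Definition phi_star_diag (R : realType) (n : nat) (l : 'rV[R]_n)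
    (p : 'I_n -> R -> R) (x : 'rV[R]_n) (i : 'I_n) : R :=
  l 0 i + \sum_(k < n | (i < k)%N)
            (\prod_(j < n | (i < j <= k)%N) p j (x 0 j)) * l 0 k.

(* The profile x is a parameter; it is meant to be the efficient profile. *)
Definition phi_star (R : realType) (n : nat) (l : 'rV[R]_n)
    (p : 'I_n -> R -> R) (x : 'rV[R]_n) (i j : 'I_n) : R :=
  if j == i then phi_star_diag l p x i
  else if (i < j)%N then (1 - p j (x 0 j)) * phi_star_diag l p x j
  else 0.

Lemma disruptor_pays_solution (R : realType) (n : nat) (l : 'rV[R]_n) :
  (forall i, 0 < l 0 i) -> solution l (disruptor_pays l).
Proof.
move=> l_gt0; split=> [i j|i j ji|i]; rewrite /disruptor_pays.
- by case: ifP => // _; apply: sumr_ge0 => k _; apply: ltW.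
- by rewrite -val_eqE ltn_eqF.
- rewrite (bigD1 i) //= eqxx [X in _ + X]big1 ?addr0 // => j /andP[_ ji].
  by rewrite (negPf ji).
Qed.

Lemma telescope_ord (R : comNzRingType) (n : nat) (q : 'I_n -> R) (i k : 'I_n) :
  \sum_(j < n | (i < j <= k)%N)
     (1 - q j) * \prod_(m < n | (j < m <= k)%N) q m
  = 1 - \prod_(m < n | (i < m <= k)%N) q m.
Proof.
have F (a b m : nat) : (b <= a)%N -> (a < m <= b)%N = false.
  by move=> ba; apply/negbTE/negP => /andP[am /(leq_trans am)]; rewrite ltnNge ba.
case: k => k /=; elim: k => [|k IHk] lt_kn.
  by rewrite !big_pred0 ?subrr // => j; rewrite F.
have lt_kn' := ltnW lt_kn; pose k1 := Ordinal lt_kn.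
have [le_ki|lt_ik] := leqP k.+1 i.
  by rewrite !big_pred0 ?subrr // => j; rewrite F.
have prodS (j : 'I_n) : (j <= k)%N ->
    \prod_(m < n | (j < m <= k.+1)%N) q m
    = q k1 * \prod_(m < n | (j < m <= k)%N) q m.
  move=> jk; rewrite (bigD1 k1) /=; last by rewrite leqnn ltnS jk.
  congr (_ * _); apply: eq_bigl => m; rewrite -val_eqE /= -andbA; congr andb.
  by rewrite andbC -ltn_neqAle ltnS.
rewrite (bigD1 k1) /=; last by rewrite lt_ik leqnn.
rewrite [X in _ * X]big_pred0; last by move=> m; rewrite F.
rewrite mulr1 prodS //.
under eq_bigl => j do
  rewrite -val_eqE /= -andbA [X in _ && X]andbC -ltn_neqAle ltnS.
under eq_bigr => j /andP[_ jk] do rewrite prodS // mulrCA.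
rewrite -mulr_sumr (IHk lt_kn') mulrBr mulr1.
by rewrite addrA subrK.
Qed.

Lemma phi_star_diagE (R : realType) (n : nat) (l : 'rV[R]_n)
    (p : 'I_n -> R -> R) (x : 'rV[R]_n) (i : 'I_n) :
  phi_star_diag l p x i
  = \sum_(k < n | (i <= k)%N)
      (\prod_(j < n | (i < j <= k)%N) p j (x 0 j)) * l 0 k.
Proof.
rewrite (bigD1 i) //= big_pred0 ?mul1r; last first.
  by move=> m; rewrite ltnNge; case: leqP.
by congr (_ + _); apply: eq_bigl => k; rewrite ltn_neqAle -val_eqE andbC eq_sym.
Qed.

Lemma phi_star_solution (R : realType) (n : nat) (l : 'rV[R]_n)
    (p : 'I_n -> R -> R) (x : 'rV[R]_n) :
  problem l p -> profile x -> solution l (phi_star l p x).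
Proof.
move=> [l_gt0 tech_p] x_ge0.
have p01 j : 0 <= p j (x 0 j) <= 1 by apply: tech_range.
have D_ge0 i : 0 <= phi_star_diag l p x i.
  rewrite phi_star_diagE; apply: sumr_ge0 => k _.
  by rewrite mulr_ge0 ?(ltW (l_gt0 k)) //; apply: prodr_ge0 => j _; case/andP: (p01 j).
split=> [i j|i j ji|i]; rewrite /phi_star.
- case: eqP => // _; case: ifP => // _.
  by rewrite mulr_ge0 // subr_ge0; case/andP: (p01 j).
- by rewrite -val_eqE ltn_eqF // ltnNge ltnW.
rewrite (bigD1 i) //= eqxx.
have -> : \sum_(j < n | (i <= j)%N && (j != i))
    (if j == i then phi_star_diag l p x i
     else if (i < j)%N then (1 - p j (x 0 j)) * phi_star_diag l p x j else 0)
  = \sum_(j < n | (i < j)%N) \sum_(k < n | (j <= k)%N)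
     (1 - p j (x 0 j)) * (\prod_(m < n | (j < m <= k)%N) p m (x 0 m)) * l 0 k.
  apply: eq_big => [j|j /andP[ij ji]].
    by rewrite ltn_neqAle -val_eqE andbC eq_sym.
  rewrite (negPf ji) ltn_neqAle ij eq_sym val_eqE ji /= phi_star_diagE mulr_sumr.
  by apply: eq_bigr => k _; rewrite mulrA.
rewrite (exchange_big_dep (fun k : 'I_n => (i <= k)%N)) /=; last first.
  by move=> j k ij jk; apply: ltnW (leq_trans ij jk).
rewrite phi_star_diagE -big_split /=; apply: eq_bigr => k _.
by rewrite -mulr_suml telescope_ord -mulrDl addrC subrK mul1r.
Qed.

(* Main.v *)
(* All agents share the technology 1 - exp (- c sqrt x), the last of n agents has loss about n and
   the others have losses in [1, 2]. The efficient cost is at most 3n, its value when nobody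
   invests. Under disruptor-pays every agent faces a liability of at least n; for
   c ^ 2 = 8 ln (2n) each then invests at least ln (2n) / 8 although it already succeeds with
   probability 1 - 1 / (2n), so the total cost is at least n ln (2n) / 8.
   A Nash equilibrium is a profile of coordinatewise best replies to the probability of being
   reached, so it exists and is unique by recursion on the agents. Every efficient profile is an
   equilibrium for phi_star. Uniqueness of the efficient profile, which may fail in general, is
   arranged by a perturbation of the losses. *)

Require Import Defs.
From mathcomp Require Import all_boot all_order all_algebra.
From mathcomp Require Import all_classical all_reals all_analysis.
From mathcomp Require Import ring lra.
Import Order.TTheory GRing.Theory Num.Theory.
Import numFieldNormedType.Exports.
Local Open Scope classical_set_scope.
Local Open Scope ring_scope.
Set Implicit Arguments.
Unset Strict Implicit.

(** * Best replies of a single agent *)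

(** An agent's own cost up to terms free of its choice; [a] stands for the probability of being
    reached times the liability [phi k k]. *)
Definition best_reply (R : realType) (f : R -> R) (a y : R) : Prop :=
  0 <= y /\ forall z, 0 <= z -> y - a * f y <= z - a * f z.

(** For [a > 0] strict concavity of [f] lets the midpoint of two minimisers do better; for [a = 0]
    the objective is the investment itself, minimal only at [0]. *)
Lemma best_reply_unique (R : realType) (f : R -> R) (a y z : R) :
  technology f -> 0 <= a -> best_reply f a y -> best_reply f a z -> y = z.
Proof.
move=> tf a_ge0 [y0 ymin] [z0 zmin]; apply/eqP/negP => /negP yz.
have yz_eq : y - a * f y = z - a * f z by apply/le_anti; rewrite ymin ?zmin.
have half : 0 < (2^-1 : R) < 1 by lra.
have conc := tech_concave tf y0 z0 yz half.
set m := 2^-1 * y + (1 - 2^-1) * z in conc.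
have m0 : 0 <= m by rewrite /m; lra.
have := ymin _ m0.
have [a0|a_gt0] := eqVneq a 0.
  move=> _; move: (ymin _ (lexx 0)) (zmin _ (lexx 0)); rewrite a0 !mul0r !subr0.
  by move=> ? ?; move/eqP: yz; apply; lra.
have {}a_gt0 : 0 < a by rewrite lt_def a_gt0.
move: conc; rewrite -(ltr_pM2l a_gt0) /m => ? ?; lra.
Qed.

(** Since [f] is at most [1], investing more than [a] costs more than it can save, which confines
    the search to a compact interval. *)
Lemma best_reply_exists (R : realType) (f : R -> R) (a : R) :
  technology f -> continuous f -> 0 <= a -> exists y, best_reply f a y.
Proof.
move=> tf cf a_ge0.
have cg : continuous (fun y : R => y - a * f y).
  by move=> y; apply: cvgB; [exact: cvg_id|apply: cvgM; [exact: cvg_cst|exact: cf]].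
have [y y0a ymin] := EVT_min a_ge0 (continuous_subspaceT cg).
move: (y0a); rewrite in_itv /= => /andP[y_ge0 ya]; exists y; split=> // z z0.
have [za|az] := leP z a; first by apply: ymin; rewrite in_itv /= z0.
apply: (@le_trans _ _ 0).
  have := ymin 0; rewrite in_itv /= lexx a_ge0 => /(_ isT).
  by rewrite (tech_0 tf) mulr0 subr0.
rewrite subr_ge0; apply: le_trans (ltW az).
by rewrite ler_piMr //; case/andP: (tech_range tf z0).
Qed.

(** * Nash equilibria, and private against total cost *)

Definition reach (R : realType) (n : nat) (p : 'I_n -> R -> R)
    (x : 'rV[R]_n) (k : nat) : R :=
  \prod_(i < n | (i < k)%N) p i (x 0 i).

Section Game.
Variables (R : realType) (n : nat) (p : 'I_n -> R -> R).
Implicit Types (x y l : 'rV[R]_n) (k : 'I_n) (phi : 'I_n -> 'I_n -> R).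

Lemma reach0 x : reach p x 0 = 1.
Proof. by rewrite /reach big_pred0. Qed.

Lemma reachS x k : reach p x k.+1 = reach p x k * p k (x 0 k).
Proof.
rewrite /reach (bigD1 k) //= mulrC; congr (_ * _); apply: eq_bigl => i.
by rewrite -val_eqE /= ltnS andbC -ltn_neqAle.
Qed.

Lemma eq_reach x y (m : nat) :
  (forall i : 'I_n, (i < m)%N -> x 0 i = y 0 i) -> reach p x m = reach p y m.
Proof. by move=> xy; apply: eq_bigr => i im; rewrite xy. Qed.

Lemma deviate_same x k (z : R) : deviate x k z 0 k = z.
Proof. by rewrite mxE eqxx. Qed.

Lemma deviate_other x k (z : R) (i : 'I_n) :
  i != k -> deviate x k z 0 i = x 0 i.
Proof. by rewrite mxE => /negPf ->. Qed.

Lemma reach_deviate x k (z : R) (m : nat) :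
  (m <= k)%N -> reach p (deviate x k z) m = reach p x m.
Proof.
move=> mk; apply: eq_reach => i im; rewrite deviate_other // -val_eqE.
by rewrite ltn_eqF // (leq_trans im).
Qed.

Lemma agent_cost_deviate phi x k (z : R) :
  agent_cost p phi (deviate x k z) k - agent_cost p phi x k
  = (z - reach p x k * phi k k * p k z)
    - (x 0 k - reach p x k * phi k k * p k (x 0 k)).
Proof.
rewrite /agent_cost -!/(reach p _ _) !deviate_same reach_deviate //.
under eq_bigr => j jk.
  rewrite -/(reach p _ _) reach_deviate; last exact: ltnW.
  rewrite deviate_other; last by rewrite -val_eqE ltn_eqF.
  over.
rewrite /reach; ring.
Qed.

Lemma nashE phi x :
  nash p phi x <-> forall k, best_reply (p k) (reach p x k * phi k k) (x 0 k).
Proof.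
split=> [[x0 xN] k|xN].
  split=> // z z0.
  by have := xN k z z0; rewrite -(subr_ge0 (agent_cost _ _ _ _)) agent_cost_deviate subr_ge0.
split=> [k|k z z0]; first by case: (xN k).
by rewrite -subr_ge0 agent_cost_deviate subr_ge0; case: (xN k) => _; apply.
Qed.

(** Among the success products only those with [j >= k] involve [x 0 k]. Each factors through
    [reach p x k * p k (x 0 k)], and the losses they weight collect into [phi_star_diag l p x k]. *)
Lemma total_costE l x k : total_cost l p x
  = \sum_(j < n) l 0 j - \sum_(j < n | (j < k)%N) reach p x j.+1 * l 0 j
    - reach p x k * p k (x 0 k) * phi_star_diag l p x k + \sum_(j < n) x 0 j.
Proof.
have tail (j : 'I_n) : (k <= j)%N -> reach p x j.+1
    = reach p x k.+1 * \prod_(i < n | (k < i <= j)%N) p i (x 0 i).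
  move=> kj; rewrite /reach (bigID (fun i : 'I_n => (i <= k)%N)) /=.
  congr (_ * _); apply: eq_bigl => i; rewrite !ltnS -?ltnNge andbC //.
  by case: leqP => // /leq_trans ->.
rewrite /total_cost; congr (_ + _).
under eq_bigr do rewrite mulrBl mul1r -[\prod_(_ < n | _) _]/(reach p x _.+1).
rewrite sumrB -addrA -opprD; congr (_ - _).
rewrite (bigID (fun j : 'I_n => (j < k)%N)) /=; congr (_ + _).
rewrite phi_star_diagE mulr_sumr -reachS; apply: eq_big => j; first by rewrite -leqNgt.
by rewrite -leqNgt => kj; rewrite tail // mulrA.
Qed.

Lemma total_cost_deviate l x k (z : R) :
  total_cost l p (deviate x k z) - total_cost l p x
  = (z - reach p x k * phi_star_diag l p x k * p k z)
    - (x 0 k - reach p x k * phi_star_diag l p x k * p k (x 0 k)).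
Proof.
rewrite !(total_costE l _ k) !deviate_same reach_deviate //.
have -> : phi_star_diag l p (deviate x k z) k = phi_star_diag l p x k.
  congr (_ + _); apply: eq_bigr => j kj; congr (_ * _).
  by apply: eq_bigr => i /andP[ki _]; rewrite deviate_other // -val_eqE gtn_eqF.
have -> : \sum_(j < n | (j < k)%N) reach p (deviate x k z) j.+1 * l 0 j
    = \sum_(j < n | (j < k)%N) reach p x j.+1 * l 0 j.
  by apply: eq_bigr => j jk; rewrite reach_deviate.
rewrite [\sum_j deviate x k z 0 j](bigD1 k) //= deviate_same.
rewrite [\sum_j x 0 j](bigD1 k) //=.
have -> : \sum_(j < n | j != k) deviate x k z 0 j = \sum_(j < n | j != k) x 0 j.
  by apply: eq_bigr => j jk; rewrite deviate_other.
ring.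
Qed.

(** A unilateral deviation from [x] changes the total cost and, under [phi_star], the deviator's own
    cost by the same amount. *)
Lemma efficient_nash l x : efficient l p x -> nash p (phi_star l p x) x.
Proof.
move=> [x0 xmin]; apply/nashE => k; rewrite /phi_star eqxx; split=> // z z0.
rewrite -subr_ge0 -total_cost_deviate subr_ge0; apply: xmin => i.
by rewrite mxE; case: ifP.
Qed.

Hypothesis tech_p : forall i, technology (p i).

Lemma reach_range x (m : nat) : profile x -> 0 <= reach p x m <= 1.
Proof.
move=> x0; apply/andP; split.
  by apply: prodr_ge0 => i _; case/andP: (tech_range (tech_p i) (x0 i)).
by apply: prodr_ile1 => i _; apply: tech_range.
Qed.

(** [reach p x k] depends only on choices before [k], so by induction agent [k] faces the same
    best-reply problem in both equilibria. *)
Lemma nash_unique phi x y :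
  (forall k, 0 <= phi k k) -> nash p phi x -> nash p phi y -> x = y.
Proof.
move=> phi0 xN yN; have [[x0 _] [y0 _]] := (xN, yN).
move/nashE: xN => xN; move/nashE: yN => yN.
suff xy (m : nat) k : (k < m)%N -> x 0 k = y 0 k.
  by apply/rowP => k; apply: (xy k.+1).
elim: m k => // m IHm k; rewrite ltnS => km.
apply: (best_reply_unique (tech_p k) _ (xN k)).
  by rewrite mulr_ge0 //; case/andP: (reach_range k x0).
rewrite (@eq_reach x y) // => i ik; apply: IHm; exact: leq_trans ik km.
Qed.

Lemma nash_exists phi :
  (forall i, continuous (p i)) -> (forall k, 0 <= phi k k) ->
  exists x, nash p phi x.
Proof.
move=> cont_p phi0.
(* The profile is built agent by agent: changing coordinate [m] leaves the problems of earlier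
   agents untouched. *)
suff /(_ n (leqnn n))[x [x0 xN]] : forall m, (m <= n)%N -> exists x, profile x /\
    forall k, (k < m)%N -> best_reply (p k) (reach p x k * phi k k) (x 0 k).
  by exists x; apply/nashE => k; apply: xN.
elim=> [|m IHm] mn; first by exists 0; split=> // k; rewrite mxE.
have [x [x0 xN]] := IHm (ltnW mn); pose k0 := Ordinal mn.
have a0 : 0 <= reach p x k0 * phi k0 k0.
  by rewrite mulr_ge0 //; case/andP: (reach_range k0 x0).
have [z zB] := best_reply_exists (tech_p k0) (cont_p k0) a0.
exists (deviate x k0 z); split=> [i|k km].
  by rewrite mxE; case: ifP => // _; case: zB.
rewrite reach_deviate //; have [->|kk0] := eqVneq k k0; first by rewrite deviate_same.
rewrite deviate_other //; apply: xN.
by rewrite ltn_neqAle -ltnS km andbT; apply: contra kk0 => /eqP e; apply/eqP/val_inj.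
Qed.

End Game.

(** * The exponential technology and its best replies *)

Definition exp_tech (R : realType) (c x : R) : R := 1 - expR (- (c * Num.sqrt x)).

Section ExpTech.
Variables (R : realType) (c : R).
Hypothesis c_gt0 : 0 < c.

Lemma exp_tech_continuous : continuous (exp_tech c).
Proof.
move=> x; apply: cvgB; first exact: cvg_cst.
apply: (@continuous_comp _ _ _ (fun x => - (c * Num.sqrt x)) expR).
  by apply: cvgN; apply: cvgM; [exact: cvg_cst|exact: sqrt_continuous].
exact: continuous_expR.
Qed.

Lemma exp_tech_is_derive (x : R) : 0 < x ->
  is_derive x 1 (exp_tech c) (c * expR (- (c * Num.sqrt x)) / (2 * Num.sqrt x)).
Proof.
move=> x0.
have dsqrt := is_derive1_sqrt x0.
have dlin : is_derive x 1 (fun y => - (c * Num.sqrt y)) (- (c * (2 * Num.sqrt x)^-1)).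
  exact: is_deriveN.
have dexp := is_derive1_comp (is_derive_expR _) dlin.
have := is_deriveB (is_derive_cst (1 : R) x 1) dexp.
congr (is_derive _ _ _ _); rewrite sub0r; ring.
Qed.

Lemma exp_tech_concave (x y t : R) : 0 <= x -> 0 <= y -> x != y -> 0 < t < 1 ->
  t * exp_tech c x + (1 - t) * exp_tech c y < exp_tech c (t * x + (1 - t) * y).
Proof.
move=> x0 y0 xy /andP[t0 t1]; rewrite /exp_tech.
set z := t * x + _; set u := Num.sqrt x; set v := Num.sqrt y.
have z0 : 0 <= z by rewrite /z addr_ge0 // mulr_ge0 //; lra.
have [u0 v0] : 0 <= u /\ 0 <= v by split; apply: sqrtr_ge0.
have [xE yE] : u ^+ 2 = x /\ v ^+ 2 = y by split; apply: sqr_sqrtr.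
(* [m] averages the square roots; strictness comes from [m < Num.sqrt z], that is, from strict
   concavity of the square root. *)
pose m := t * u + (1 - t) * v.
have m0 : 0 <= m by rewrite /m addr_ge0 // mulr_ge0 //; lra.
have mz : m < Num.sqrt z.
  rewrite -(ltr_pXn2r (ltn0Sn 1)) ?nnegrE ?sqrtr_ge0 // sqr_sqrtr // -subr_gt0.
  have -> : z - m ^+ 2 = t * (1 - t) * (u - v) ^+ 2.
    by rewrite /z /m -xE -yE; ring.
  rewrite pmulr_rgt0; last by rewrite mulr_gt0 ?subr_gt0.
  rewrite exprn_even_gt0 //= subr_eq0.
  by apply: contra xy => /eqP uv; rewrite -xE -yE uv.
(* Convexity of the exponential enters through its tangent line at [- (c * m)]. *)
have tangent w : expR (- (c * m)) * (1 + (c * m - c * w)) <= expR (- (c * w)).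
  have -> : expR (- (c * w)) = expR (- (c * m)) * expR (c * m - c * w).
    by rewrite -expRD; congr expR; ring.
  by rewrite ler_pM2l ?expR_gt0 // expR_ge1Dx.
have em : expR (- (c * m)) <= t * expR (- (c * u)) + (1 - t) * expR (- (c * v)).
  have -> : expR (- (c * m)) = t * (expR (- (c * m)) * (1 + (c * m - c * u)))
      + (1 - t) * (expR (- (c * m)) * (1 + (c * m - c * v))).
    by rewrite [in X in _ = t * (_ * (1 + (X - _))) + _]/m
       [in X in _ = _ + (1 - t) * (_ * (1 + (X - _)))]/m; ring.
  by apply: lerD; rewrite ler_pM2l ?subr_gt0.
have ez : expR (- (c * Num.sqrt z)) < expR (- (c * m)).
  by rewrite ltr_expR ltrN2 ltr_pM2l.
lra.
Qed.

Lemma exp_tech_technology : technology (exp_tech c).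
Proof.
split.
- move=> x x0; rewrite /exp_tech subr_ge0 expR_le1 oppr_le0 lerBlDr lerDl.
  by rewrite expR_ge0 mulr_ge0 ?sqrtr_ge0 // ltW.
- move=> x y x0 xy; rewrite /exp_tech ltrD2l ltrN2 ltr_expR ltrN2 ltr_pM2l //.
  by rewrite ltr_sqrt // (le_lt_trans x0).
- exact: exp_tech_concave.
- by apply: continuous_subspaceT; exact: exp_tech_continuous.
- by move=> x x0; have dx := exp_tech_is_derive x0; exact: ex_derive.
- by rewrite /exp_tech sqrtr0 mulr0 oppr0 expR0 subrr.
apply/cvgryPge => A; pose K := `|A| + 1.
have K0 : 0 < K by rewrite ltr_wpDl.
(* For [x < d ^+ 2] the first bound makes the exponential factor at least [1/2], and the second
   makes [c / (4 * Num.sqrt x)] at least [K]. *)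
pose d := Num.min (2 * c)^-1 (c / (4 * K)).
have d0 : 0 < d by rewrite /d lt_min invr_gt0 divr_gt0 ?mulr_gt0.
have d20 : 0 < d ^+ 2 by rewrite exprn_gt0.
near=> x.
have x0 : 0 < x by near: x; exact: nbhs_right_gt.
have xd : x < d ^+ 2 by near: x; exact: nbhs_right_lt.
rewrite derive1E (@derive_val _ _ _ _ _ _ _ (exp_tech_is_derive x0)).
set s := Num.sqrt x; have s0 : 0 < s by rewrite sqrtr_gt0.
have sd : s <= d.
  by rewrite -[leRHS]ger0_norm ?(ltW d0) // -sqrtr_sqr ler_wsqrtr // ltW.
have sc : c * s <= 2^-1.
  have : s <= (2 * c)^-1 by apply: le_trans sd _; rewrite /d ge_min lexx.
  rewrite invfM -(ler_pM2l c_gt0) mulrCA mulfV ?mulr1 //; exact: lt0r_neq0.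
have sK : 4 * K * s <= c.
  have : s <= c / (4 * K) by apply: le_trans sd _; rewrite /d ge_min lexx orbT.
  by rewrite ler_pdivlMr ?mulr_gt0 // mulrC.
have e2 : 2^-1 <= expR (- (c * s)).
  by apply: le_trans (expR_ge1Dx _); lra.
apply: (@le_trans _ _ K); first by rewrite /K; have := ler_norm A; lra.
rewrite ler_pdivlMr ?mulr_gt0 //.
apply: (@le_trans _ _ (c * 2^-1)); first by lra.
by rewrite ler_pM2l.
Unshelve. all: by end_near.
Qed.

(* In the variable [t = c * Num.sqrt y] the objective is [t ^+ 2 / c ^+ 2 + a * expR (- t)] up to
   a constant, and it decreases as long as [2 * t <= a * c ^+ 2 * expR (- t)]. *)
Lemma exp_tech_best_reply_ge (a T y : R) : 0 <= T ->
  2 * T <= a * c ^+ 2 * expR (- T) -> best_reply (exp_tech c) a y ->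
  T <= c * Num.sqrt y.
Proof.
move=> T0 aT [y0 ymin]; rewrite leNgt; apply/negP => yT.
set t := c * _ in yT; have t0 : 0 <= t by rewrite mulr_ge0 ?sqrtr_ge0 ?ltW.
have T_gt0 : 0 < T by apply: le_lt_trans t0 yT.
(* The competitor [z] is the investment at which the variable [t] takes the value [T]. *)
pose z := (T / c) ^+ 2.
have := ymin z (sqr_ge0 _); rewrite /exp_tech.
have -> : c * Num.sqrt z = T.
  by rewrite /z sqrtr_sqr ger0_norm ?divr_ge0 ?ltW // mulrCA mulfV ?mulr1 ?lt0r_neq0.
rewrite -/t => yz.
have {}yz : c ^+ 2 * (a * (expR (- t) - expR (- T))) <= T ^+ 2 - t ^+ 2.
  have -> : T ^+ 2 - t ^+ 2 = c ^+ 2 * (z - y).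
    rewrite /t exprMn sqr_sqrtr // mulrBr /z exprMn exprVn mulrCA mulfV ?mulr1 //.
    by rewrite expf_neq0 ?lt0r_neq0.
  by rewrite ler_pM2l ?exprn_gt0 //; lra.
have a0 : 0 < a * c ^+ 2.
  by rewrite -(pmulr_lgt0 _ (expR_gt0 (- T))); apply: lt_le_trans aT; rewrite mulr_gt0.
have et : expR (- T) * (T - t) <= expR (- t) - expR (- T).
  have -> : expR (- t) = expR (- T) * expR (T - t).
    by rewrite -expRD; congr expR; ring.
  rewrite lerBrDr -[X in _ + X]mulr1 -mulrDr ler_pM2l ?expR_gt0 // addrC.
  exact: expR_ge1Dx.
have : a * c ^+ 2 * (expR (- T) * (T - t)) <= T ^+ 2 - t ^+ 2.
  by apply: le_trans yz; rewrite [leRHS]mulrA [c ^+ 2 * a]mulrC ler_pM2l.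
(* Cancelling [T - t] leaves [a * c ^+ 2 * expR (- T) <= T + t < 2 * T], against the hypothesis. *)
rewrite mulrA subr_sqr mulrC ler_pM2l ?subr_gt0 //; lra.
Qed.

End ExpTech.

(** * Continuity, and losses with a unique efficient profile *)

Lemma continuous_mul (R : realType) (T : topologicalType) (f g : T -> R) :
  continuous f -> continuous g -> continuous (fun x => f x * g x).
Proof. by move=> cf cg x; apply: cvgM; [exact: cf|exact: cg]. Qed.

Lemma continuous_add (R : realType) (T : topologicalType) (f g : T -> R) :
  continuous f -> continuous g -> continuous (fun x => f x + g x).
Proof. by move=> cf cg x; apply: cvgD; [exact: cf|exact: cg]. Qed.

Lemma continuous_sub (R : realType) (T : topologicalType) (f g : T -> R) :
  continuous f -> continuous g -> continuous (fun x => f x - g x).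
Proof. by move=> cf cg x; apply: cvgB; [exact: cf|exact: cg]. Qed.

Lemma continuous_sum (R : realType) (T : topologicalType) (I : Type) (r : seq I)
    (F : I -> T -> R) :
  (forall i, continuous (F i)) -> continuous (fun x => \sum_(i <- r) F i x).
Proof. by move=> cF; apply: continuous_big => // x; apply: add_continuous. Qed.

Section Efficient.
Variables (R : realType) (n : nat) (p : 'I_n -> R -> R).
Implicit Types (x y l : 'rV[R]_n).
Hypothesis tech_p : forall i, technology (p i).
Hypothesis cont_p : forall i, continuous (p i).

Lemma reach_continuous (m : nat) : continuous (fun x => reach p x m).
Proof.
apply: continuous_big; first exact: mul_continuous.
move=> i _ x; apply: (@continuous_comp _ _ _ (fun x : 'rV[R]_n => x 0 i) (p i)).
  exact: coord_continuous.
exact: cont_p.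
Qed.

Lemma total_cost_continuous l : continuous (total_cost l p).
Proof.
apply: continuous_add; apply: continuous_sum => j; last exact: coord_continuous.
apply: continuous_mul; last exact: cst_continuous.
by apply: continuous_sub; [exact: cst_continuous|exact: (@reach_continuous j.+1)].
Qed.

Lemma total_cost_ge l x : profile x -> (forall i, 0 <= l 0 i) ->
  \sum_(j < n) x 0 j <= total_cost l p x.
Proof.
move=> x0 l0; rewrite lerDr; apply: sumr_ge0 => j _; rewrite mulr_ge0 // subr_ge0.
by case/andP: (reach_range tech_p j.+1 x0).
Qed.

Lemma total_cost0_le l : (forall i, 0 <= l 0 i) ->
  total_cost l p 0 <= \sum_(j < n) l 0 j.
Proof.
move=> l0; rewrite /total_cost [X in _ + X]big1 => [|j _]; last by rewrite mxE.
have profile0 : profile (0 : 'rV[R]_n) by move=> i; rewrite mxE.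
rewrite addr0; apply: ler_sum => j _; rewrite ler_piMl // lerBlDr lerDl.
by case/andP: (reach_range tech_p j.+1 profile0).
Qed.

(* Two efficient profiles with the same success probabilities coincide: either agent [k] is
   reached and the probability determines [x k], or it is not and best replies with [0]. *)
Lemma efficient_reach_inj l x y : (forall i, 0 <= l 0 i) ->
  efficient l p x -> efficient l p y ->
  (forall k : 'I_n, reach p x k.+1 = reach p y k.+1) -> x = y.
Proof.
move=> l0 xE yE xy; have [[x0 _] [y0 _]] := (xE, yE).
have xyk (k : 'I_n) : reach p x k = reach p y k.
  case: k => -[|k] kn; first by rewrite !reach0.
  exact: (xy (Ordinal (ltnW kn))).
apply/rowP => k.
have [rx0|rx0] := eqVneq (reach p x k) 0.
  move/efficient_nash/nashE/(_ k): xE; move/efficient_nash/nashE/(_ k): yE.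
  rewrite -xyk rx0 !mul0r => yB xB; exact: (best_reply_unique (tech_p k) _ xB yB).
have := xy k; rewrite !reachS -xyk => /(mulfI rx0) pxy.
case: (ltgtP (x 0 k) (y 0 k)) => //.
  by move/(tech_incr (tech_p k) (x0 k)); rewrite pxy ltxx.
by move/(tech_incr (tech_p k) (y0 k)); rewrite pxy ltxx.
Qed.

(* A minimiser [x] of [total_cost l0 p y - 1/2 \sum_j reach p y j.+1 ^+ 2] exists by compactness;
   replacing the concave penalty by its tangent at [x] turns it into a change of the losses and
   makes [x] the only minimiser, up to the probabilities [reach]. *)
Lemma unique_efficient_perturb (l0 : 'rV[R]_n) : (forall i, 0 < l0 0 i) ->
  exists l x, (forall i, l0 0 i <= l 0 i <= l0 0 i + 1) /\ unique (efficient l p) x.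
Proof.
move=> l0_gt0; have l0_ge0 i := ltW (l0_gt0 i).
pose F x := total_cost l0 p x - 2^-1 * \sum_(j < n) reach p x j.+1 ^+ 2.
have FC : continuous F.
  apply: continuous_sub; first exact: total_cost_continuous.
  apply: continuous_mul; first exact: cst_continuous.
  by apply: continuous_sum => j; apply: continuous_mul; exact: reach_continuous.
(* A coordinate above [M] makes [F] exceed [F 0] even after the penalty, at most [n / 2], is
   subtracted; minimising over [box] therefore suffices. *)
pose M := \sum_(j < n) l0 0 j + n%:R.
have M0 : 0 <= M by rewrite addr_ge0 // sumr_ge0.
pose box := [set x : 'rV[R]_n | forall i, `[0, M]%classic (x 0 i)].
have box0 : box 0 by move=> i; rewrite /= mxE in_itv /= lexx.
have [x xbox xmin] : exists2 x, x \in box & forall y, y \in box -> F x <= F y.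
  apply: EVT_min_rV; [by exists 0| |exact: continuous_subspaceT].
  apply: (@rV_compact _ _ (fun=> `[0, M]%classic)) => i; exact: segment_compact.
move: xbox; rewrite inE => xbox.
have x0 : profile x by move=> i; have := xbox i; rewrite /= in_itv => /andP[].
have {}xmin y : profile y -> F x <= F y.
  move=> y0; have [ybox|] := pselect (box y); first by apply: xmin; rewrite inE.
  move=> /existsNP[i] /=; rewrite in_itv /= y0 /= => /negP; rewrite -ltNge => Mi.
  apply: (le_trans (xmin 0 _)); first by rewrite inE.
  apply: (@le_trans _ _ (\sum_(j < n) l0 0 j)).
    apply: le_trans (total_cost0_le l0_ge0); rewrite gerBl mulr_ge0 // sumr_ge0 // => j _.
    exact: sqr_ge0.
  have sq : \sum_(j < n) reach p y j.+1 ^+ 2 <= n%:R.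
    rewrite -[n in n%:R]card_ord -sumr_const; apply: ler_sum => j _.
    by rewrite exprn_ile1 //; case/andP: (reach_range tech_p j.+1 y0).
  have yi : y 0 i <= \sum_(j < n) y 0 j.
    by rewrite (bigD1 i) //= lerDl sumr_ge0.
  have := total_cost_ge y0 l0_ge0; rewrite /F /M in Mi *.
  have : (0 : R) <= n%:R by []. lra.
(* The added losses are the slopes of the penalty at [x]. The gap between penalty and tangent is the
   half sum of squares in [lE], which must vanish at any other efficient profile. *)
pose l := \row_j (l0 0 j + reach p x j.+1).
have lE y : total_cost l p y - total_cost l p x
    = F y - F x + 2^-1 * \sum_(j < n) (reach p y j.+1 - reach p x j.+1) ^+ 2.
  have tl z : total_cost l p z = total_cost l0 p z
      + \sum_(j < n) (1 - reach p z j.+1) * reach p x j.+1.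
    rewrite /total_cost [RHS]addrAC -[X in _ = X + _]big_split /=; congr (_ + _); apply: eq_bigr => j _.
    by rewrite mxE mulrDr.
  have sq : \sum_(j < n) (reach p y j.+1 - reach p x j.+1) ^+ 2
     = \sum_(j < n) reach p y j.+1 ^+ 2 - \sum_(j < n) reach p x j.+1 ^+ 2
     + 2 * (\sum_(j < n) (1 - reach p y j.+1) * reach p x j.+1
            - \sum_(j < n) (1 - reach p x j.+1) * reach p x j.+1).
    by rewrite -!sumrB mulr_sumr -big_split; apply: eq_bigr => j _ /=; ring.
  by rewrite !tl sq /F; field.
have l_ge i : l0 0 i <= l 0 i <= l0 0 i + 1.
  by rewrite mxE lerDl lerD2l; exact: reach_range.
have l_ge0 i : 0 <= l 0 i by apply: le_trans (l0_ge0 i) _; case/andP: (l_ge i).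
have sq_ge0 y : 0 <= \sum_(j < n) (reach p y j.+1 - reach p x j.+1) ^+ 2.
  by apply: sumr_ge0 => j _; exact: sqr_ge0.
have xE : efficient l p x.
  split=> // y y0; rewrite -subr_ge0 lE addr_ge0 ?mulr_ge0 //.
  by rewrite subr_ge0 xmin.
exists l, x; split=> //; split=> // y yE.
apply: (efficient_reach_inj l_ge0 xE yE) => k.
have : \sum_(j < n) (reach p y j.+1 - reach p x j.+1) ^+ 2 <= 0.
  have := lE y; have := yE.2 _ x0; have := xmin _ yE.1; lra.
rewrite le_eqVlt ltNge sq_ge0 orbF psumr_eq0 => [/allP/(_ k)|j _]; last exact: sqr_ge0.
by rewrite mem_index_enum /= sqrf_eq0 subr_eq0 => /(_ isT)/eqP.
Qed.

End Efficient.

(** * Overinvestment under disruptor-pays, and the comparison of costs *)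

(* By induction an agent is reached with probability at least 1/2: as long as this holds, each
   agent succeeds with probability at least [1 - 1 / (2 * n)]. *)
Lemma disruptor_pays_invest (R : realType) (m : nat) (c : R) (l x : 'rV[R]_m.+1) :
  0 < c -> c ^+ 2 = 8 * ln (2 * m.+1%:R) ->
  (forall i, 0 <= l 0 i) -> m.+1%:R <= l 0 ord_max ->
  nash (fun=> exp_tech c) (disruptor_pays l) x ->
  forall k, ln (2 * m.+1%:R) / 8 <= x 0 k.
Proof.
set N : R := m.+1%:R; set T := ln _ => c0 cT l0 l_big xN.
have N1 : 1 <= N by rewrite ler1n.
have T0 : 0 < T by rewrite ln_gt0; lra.
have [e [e_gt0 eT eN]] : exists e, [/\ 0 < e, expR (- T) = e & e * N = 2^-1].
  exists (2 * N)^-1; split; [by rewrite invr_gt0; lra| |by field; lra].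
  by rewrite expRN lnK // posrE; lra.
have e_ge0 := ltW e_gt0.
have tech_c (i : 'I_m.+1) := exp_tech_technology c0.
have [x0 _] := xN; move/nashE: xN => xN.
have diag_ge (k : 'I_m.+1) : N <= disruptor_pays l k k.
  rewrite /disruptor_pays eqxx (bigD1 ord_max) /=; last by rewrite -ltnS.
  by apply: le_trans l_big _; rewrite lerDl; apply: sumr_ge0.
have invest (k : 'I_m.+1) : 2^-1 <= reach (fun=> exp_tech c) x k ->
    T <= c * Num.sqrt (x 0 k).
  move=> rk; apply: (exp_tech_best_reply_ge c0 (ltW T0) _ (xN k)).
  have rN : 2^-1 * N <= reach (fun=> exp_tech c) x k * disruptor_pays l k k.
    by apply: ler_pM => //; lra.
  (* The factor [8] in [c ^+ 2] is tuned to this: a stake of [N / 2] together with [e * N = 1/2]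
     gives exactly [2 * T]. *)
  have -> : 2 * T = 8 * T * (2^-1 * N) * e by rewrite -mulrA [_ * N * e]mulrAC; nra.
  rewrite eT cT ler_pM2r // mulrC ler_pM2r ?mulr_gt0 //.
have reach_ge (k : nat) : (k <= m.+1)%N ->
    1 - k%:R * e <= reach (fun=> exp_tech c) x k.
  elim: k => [_|k IHk km]; first by rewrite reach0 mul0r subr0.
  have {IHk} rk := IHk (ltnW km).
  rewrite (reachS _ x (Ordinal km)) /=.
  have kN : k%:R * e <= 2^-1.
    rewrite -eN mulrC ler_wpM2l //.
    by rewrite ler_nat ltnW.
  have half : 2^-1 <= reach (fun=> exp_tech c) x k by lra.
  have pk : 1 - e <= exp_tech c (x 0 (Ordinal km)).
    by rewrite lerD2l lerN2 -eT ler_expR lerN2 (invest (Ordinal km)).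
  have kN0 : 0 <= k%:R * e by rewrite mulr_ge0.
  have iN1 : e <= 2^-1 by rewrite -[leRHS]eN ler_peMr.
  (* The product of the two lower bounds exceeds the target by [k%:R * e ^+ 2]. *)
  apply: le_trans (ler_pM _ _ rk pk); [|lra|lra].
  rewrite -natr1 mulrDl mul1r; nra.
move=> k.
have half : 2^-1 <= reach (fun=> exp_tech c) x k.
  apply: le_trans (reach_ge k (ltnW (ltn_ord k))).
  suff : k%:R * e <= 2^-1 by lra.
  rewrite -[leRHS]eN mulrC ler_wpM2l //.
  by rewrite ler_nat ltnW.
have := invest k half.
(* Squaring turns the bound into [T ^+ 2 <= 8 * T * x 0 k]. *)
rewrite -(ler_pXn2r (ltn0Sn 1)) ?nnegrE ?(ltW T0) ?mulr_ge0 ?sqrtr_ge0 ?(ltW c0) //.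
rewrite exprMn sqr_sqrtr // cT expr2 mulrAC ler_pM2r //.
by rewrite ler_pdivrMr // mulrC.
Qed.

Theorem theorem3 (R : realType) (B : R) (B_gt0 : 0 < B) :
  exists (n : nat) (l : 'rV[R]_n) (p : 'I_n -> R -> R),
    problem l p /\
    exists x_eff x_hat x_star : 'rV[R]_n,
      [/\ unique (efficient l p) x_eff,
          unique (nash p (disruptor_pays l)) x_hat,
          unique (nash p (phi_star l p x_eff)) x_star
        & total_cost l p x_hat > B * total_cost l p x_star].
Proof.
(* This size forces [ln (2 * N) > 24 * B], so that the lower bound [N * (T / 8)] beats
   [B * (3 * N)]. *)
pose m := Num.truncn (expR (24 * B)); pose N : R := m.+1%:R.
have N_gt : expR (24 * B) < N by exact: truncnS_gt.
have N1 : 1 <= N by rewrite ler1n.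
pose T := ln (2 * N).
have T_gt : 24 * B < T.
  by rewrite -ltr_expR /T lnK ?posrE; lra.
have T0 : 0 < T by lra.
pose c := Num.sqrt (8 * T).
have c0 : 0 < c by rewrite sqrtr_gt0 mulr_gt0.
have cT : c ^+ 2 = 8 * T by rewrite sqr_sqrtr // mulr_ge0 // ltW.
pose p (i : 'I_m.+1) := exp_tech c.
have tech_p i : technology (p i) := exp_tech_technology c0.
have cont_p i : continuous (p i) := @exp_tech_continuous R c.
(* These losses sum to less than [2 * N], and the perturbation adds at most [1] per agent. *)
pose l0 : 'rV[R]_m.+1 := \row_j (if j == ord_max then N else 1).
have l0_gt0 i : 0 < l0 0 i by rewrite mxE; case: ifP => _; lra.
have [l [x [l_l0 xE]]] := unique_efficient_perturb tech_p cont_p l0_gt0.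
have l_gt0 i : 0 < l 0 i.
  by apply: lt_le_trans (l0_gt0 i) _; case/andP: (l_l0 i).
have l_ge0 i := ltW (l_gt0 i).
have l_big : N <= l 0 ord_max.
  by have /andP[] := l_l0 ord_max; rewrite mxE eqxx.
have suml : \sum_(j < m.+1) l 0 j <= 3 * N.
  apply: (@le_trans _ _ (\sum_(j < m.+1) (l0 0 j + 1))).
    by apply: ler_sum => j _; case/andP: (l_l0 j).
  rewrite big_split /= sumr_const card_ord -/N (bigD1 ord_max) //= mxE eqxx.
  suff : \sum_(j < m.+1 | j != ord_max) l0 0 j <= N by lra.
  apply: (@le_trans _ _ (\sum_(j < m.+1) 1)); last by rewrite sumr_const card_ord.
  rewrite [leRHS](bigD1 ord_max) //= -[leLHS]add0r lerD //; apply: ler_sum => j jm.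
  by rewrite mxE (negPf jm).
have [hat_sol _ _] := disruptor_pays_solution l_gt0.
have [star_sol _ _] := phi_star_solution (conj l_gt0 tech_p) xE.1.1.
have [y yN] := nash_exists tech_p cont_p (fun k => hat_sol k k).
(* The efficient profile [x] doubles as the equilibrium for [phi_star]. *)
exists m.+1, l, p; split=> //; exists x, y, x; split=> //.
- by split=> // z; apply: nash_unique yN.
- have xN := efficient_nash xE.1.
  by split=> // z; apply: nash_unique xN.
have y_ge := disruptor_pays_invest c0 cT l_ge0 l_big yN.
have yC : N * (T / 8) <= total_cost l p y.
  apply: le_trans (total_cost_ge tech_p yN.1 l_ge0).
  rewrite mulr_natl -[m.+1 in leLHS]card_ord -sumr_const; exact: ler_sum.
have xC : total_cost l p x <= 3 * N.
  apply: le_trans suml; apply: le_trans (total_cost0_le tech_p l_ge0).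
  by apply: xE.1.2 => i; rewrite mxE.
apply: lt_le_trans yC; apply: (@le_lt_trans _ _ (B * (3 * N))).
  by rewrite ler_pM2l.
have -> : B * (3 * N) = N * (3 * B) by ring.
by rewrite ltr_pM2l; lra.
Qed.
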